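(* Let $A\in\mathbb{C}^{n\times n}$ have index $k$, let $m$ be a positive integer, and let $A_1=AA^{\mathrm{w}_m}A$. Then the system of equations in $X\in\mathbb{C}^{n\times n}$ $$XAX=X,\qquad AX=A_1A^\dagger,\qquad XA=A^DA_1$$ is consistent, and its unique solution is $$X=A^DA_1A^\dagger=A^DAA^{\mathrm{w}_m}AA^\dagger.$$
   Context: $r(\cdot)$ denotes rank, $A^\dagger$ the Moore-Penrose inverse and $A^D$ the Drazin inverse. The index of $A\in\mathbb{C}^{n\times n}$ is the smallest nonnegative integer $k$ with $r(A^{k+1})=r(A^k)$ (with $A^0=I_n$). For $A$ of index $k$, the core-EP inverse is $A^{\mathrm{cEP}}=A^DA^k(A^k)^\dagger$ and the $m$-weak group inverse is $A^{\mathrm{w}_m}=(A^{\mathrm{cEP}})^{m+1}A^m$. *)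

(* Defs.v *)
From HB Require Import structures.
From mathcomp Require Import all_boot all_order all_algebra.
From mathcomp Require Import classical_sets reals.
From mathcomp Require Import complex.

Set Implicit Arguments.
Unset Strict Implicit.
Unset Printing Implicit Defensive.

Import Order.TTheory GRing.Theory Num.Theory.
Local Open Scope ring_scope.
Local Open Scope sesquilinear_scope.

Lemma drazin_ring_uniq (S : pzRingType) (a x y : S) k :
  x * a * x = x -> a * x = x * a -> a ^+ k.+1 * x = a ^+ k ->
  y * a * y = y -> a * y = y * a -> a ^+ k.+1 * y = a ^+ k -> x = y.
Proof.
have pow z j : z * a * z = z -> a * z = z * a -> z = z ^+ j.+1 * a ^+ j.
  move=> z1 z2; elim: j => [|j IH]; first by rewrite mulr1.
  have cz : a * z ^+ j.+1 = z ^+ j.+1 * a by exact: commrX.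
  have cz' : a ^+ j * z = z * a ^+ j by apply/commr_sym/commrX/commr_sym.
  rewrite [z ^+ j.+2]exprSr [a ^+ j.+1]exprS -(mulrA _ z) (mulrA z a) -z2 -(mulrA a z).
  by rewrite -cz' !mulrA -cz -(mulrA a) -IH z2 z1.
move=> x1 x2 x3 y1 y2 y3.
have ex : x = x * a * y by rewrite {1}(pow x k x1 x2) -y3 [a ^+ k.+1]exprSr !mulrA -pow.
have cx : a ^+ k.+1 * x = x * a ^+ k.+1 by apply/commr_sym/commrX/commr_sym.
have cy : y ^+ k.+1 * a ^+ k = a ^+ k * y ^+ k.+1.
  by apply: commrX; apply: commr_sym; apply: commrX.
have ey : y = x * a * y.
  rewrite {1}(pow y k y1 y2) cy -{1}x3 cx [a ^+ k.+1]exprS !mulrA -(mulrA _ (a ^+ k)) -cy.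
  by rewrite -pow.
by rewrite ex -ey.
Qed.

Lemma drazin_ring_ex (S : pzRingType) (a v w : S) k :
  a ^+ k = a ^+ k.+1 * v -> a ^+ k = w * a ^+ k.+1 ->
  exists x, [/\ x * a * x = x, a * x = x * a & a ^+ k.+1 * x = a ^+ k].
Proof.
move=> av wa.
have AV j : a ^+ (j + k) * v ^+ j = a ^+ k.
  elim: j => [|j IH]; first by rewrite mulr1.
  by rewrite addSnnS exprD [v ^+ _]exprS mulrA -(mulrA _ _ v) -av -exprD IH.
have WA j : w ^+ j * a ^+ (k + j) = a ^+ k.
  elim: j => [|j IH]; first by rewrite addn0 mul1r.
  by rewrite -addSnnS exprD [w ^+ _]exprSr mulrA -(mulrA _ w) -wa -mulrA -exprD IH.
have WV j : a ^+ k * v ^+ j = w ^+ j * a ^+ k.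
  by rewrite -{1}(WA j) -mulrA addnC AV.
have AD : a * (a ^+ k * v ^+ k.+1) = a ^+ k * v ^+ k.
  by rewrite mulrA -exprS [v ^+ _]exprS mulrA -av.
have DA : a ^+ k * v ^+ k.+1 * a = a ^+ k * v ^+ k.
  by rewrite WV -mulrA -exprSr [w ^+ _]exprSr -mulrA -wa WV.
exists (a ^+ k * v ^+ k.+1); split.
- by rewrite DA mulrA WV -(mulrA _ (a ^+ k) (a ^+ k)) -exprD WA.
- by rewrite AD DA.
- by rewrite exprSr -mulrA AD mulrA -exprD AV.
Qed.

Section Index.
Variables (F : fieldType) (n : nat).
Implicit Type A : 'M[F]_n.

Lemma mxindex_subproof A : exists k, \rank (A ^+ k.+1) == \rank (A ^+ k).
Proof.
have rkS k : (\rank (A ^+ k.+1) <= \rank (A ^+ k))%N.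
  by rewrite exprS mxrankM_maxr.
suff H b : forall k, (\rank (A ^+ k) <= b)%N ->
    exists k, \rank (A ^+ k.+1) == \rank (A ^+ k) by exact: (H _ 0%N (leqnn _)).
elim: b => [|b IH] k rk.
  by exists k; rewrite eqn_leq rkS (leq_trans rk).
have [e|ne] := eqVneq (\rank (A ^+ k.+1)) (\rank (A ^+ k)).
  by exists k; rewrite e.
by apply: (IH k.+1); rewrite -ltnS (leq_trans _ rk)// ltn_neqAle ne rkS.
Qed.

Definition mxindex A : nat := ex_minn (mxindex_subproof A).

Definition is_drazin A (X : 'M[F]_n) : Prop :=
  [/\ X *m A *m X = X,
      A *m X = X *m A &
      A ^+ (mxindex A).+1 *m X = A ^+ mxindex A].

(* The default value 0 is never used, by [drazinP]. *)
Definition drazin A : 'M[F]_n := xget 0 (is_drazin A).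

Lemma is_drazin_uniq A X Y : is_drazin A X -> is_drazin A Y -> X = Y.
Proof. by move=> [X1 X2 X3] [Y1 Y2 Y3]; apply: drazin_ring_uniq X3 Y1 Y2 Y3. Qed.

Lemma drazinP A : is_drazin A (drazin A).
Proof.
apply: xgetPex; rewrite /is_drazin /mxindex.
case: ex_minnP => k /eqP rk _.
have sub : (A ^+ k <= A ^+ k.+1)%MS.
  by rewrite -(geq_leqif (mxrank_leqif_sup _)) ?rk// exprS submxMl.
have subT : ((A ^+ k)^T <= (A ^+ k.+1)^T)%MS.
  rewrite -(geq_leqif (mxrank_leqif_sup _)) ?mxrank_tr ?rk//.
  by rewrite exprSr trmx_mul submxMl.
have [W eW] := submxP sub; have [V eV] := submxP subT.
apply: (@drazin_ring_ex 'M[F]_n A V^T W k) => //.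
by apply: trmx_inj; rewrite eV trmx_mul trmxK.
Qed.

End Index.

Section MoorePenrose.
Variable C : numClosedFieldType.

Definition is_mpinv m n (A : 'M[C]_(m, n)) (X : 'M[C]_(n, m)) : Prop :=
  [/\ A *m X *m A = A,
      X *m A *m X = X,
      (A *m X)^t* = A *m X &
      (X *m A)^t* = X *m A].

(* The default value 0 is never used, by [mpinvP]. *)
Definition mpinv m n (A : 'M[C]_(m, n)) : 'M[C]_(n, m) := xget 0 (is_mpinv A).

Lemma trmxC_mul m n p (A : 'M[C]_(m, n)) (B : 'M[C]_(n, p)) :
  (A *m B)^t* = B^t* *m A^t*.
Proof. by rewrite trmx_mul map_mxM. Qed.

Lemma is_mpinv_uniq m n (A : 'M[C]_(m, n)) X Y :
  is_mpinv A X -> is_mpinv A Y -> X = Y.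
Proof.
move=> [X1 X2 X3 X4] [Y1 Y2 Y3 Y4].
have eA : A *m X = A *m Y.
  have e : A *m X = A *m Y *m (A *m X) by rewrite mulmxA Y1.
  by rewrite -X3 e trmxC_mul X3 Y3 mulmxA X1.
have eB : X *m A = Y *m A.
  have e : X *m A = X *m A *m (Y *m A) by rewrite -!mulmxA [A *m (_ *m _)]mulmxA Y1.
  by rewrite -X4 e trmxC_mul X4 Y4 -mulmxA [A *m (_ *m _)]mulmxA X1.
by rewrite -X2 -mulmxA eA mulmxA eB Y2.
Qed.

Lemma gram_unit m n (G : 'M[C]_(m, n)) : row_free G -> G *m G^t* \in unitmx.
Proof.
move=> Gfree; rewrite -row_free_unit -kermx_eq0; apply/rowV0P => v /sub_kermxP v0.
have : v *m G == 0.
  apply/negPn/negP => /dotmx_is_dotmx.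
  by rewrite dotmxE trmxC_mul mulmxA -(mulmxA v G) v0 mul0mx mxE ltxx.
by rewrite mulmx_free_eq0// => /eqP.
Qed.

Lemma mpinvP m n (A : 'M[C]_(m, n)) : is_mpinv A (mpinv A).
Proof.
apply: xgetPex.
have [r [F [G [eA Ffull Gfree]]]] : exists r (F : 'M[C]_(m, r)) (G : 'M_(r, n)),
    [/\ A = F *m G, row_full F & row_free G].
  exists (\rank A), (col_base A), (row_base A).
  by rewrite mulmx_base col_base_full row_base_free.
have uG := gram_unit Gfree.
have uF : F^t* *m F \in unitmx.
  by rewrite -{2}(trmxCK F) gram_unit// /row_free mxrank_map mxrank_tr.
have hI p (B : 'M[C]_p) : B^t* = B -> (invmx B)^t* = invmx B.
  by move=> hB; rewrite trmx_inv map_invmx hB.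
pose P := invmx (G *m G^t*); pose Q := invmx (F^t* *m F).
have hP : P^t* = P by apply: hI; rewrite trmxC_mul trmxCK.
have hQ : Q^t* = Q by apply: hI; rewrite trmxC_mul trmxCK.
exists (G^t* *m P *m (Q *m F^t*)).
have AX : A *m (G^t* *m P *m (Q *m F^t*)) = F *m Q *m F^t*.
  rewrite eA !mulmxA -[F *m G *m _]mulmxA -[F *m _ *m P]mulmxA mulmxV//.
  by rewrite mulmx1.
have XA : G^t* *m P *m (Q *m F^t*) *m A = G^t* *m P *m G.
  rewrite eA !mulmxA -[_ *m F^t* *m F]mulmxA -[_ *m Q *m (_ *m _)]mulmxA mulVmx//.
  by rewrite mulmx1.
split.
- rewrite AX eA mulmxA -[_ *m F^t* *m F]mulmxA -[F *m Q *m _]mulmxA mulVmx//.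
  by rewrite mulmx1.
- rewrite XA !mulmxA -[_ *m G *m G^t*]mulmxA -[_ *m P *m (_ *m _)]mulmxA mulVmx//.
  by rewrite mulmx1.
- by rewrite AX !trmxC_mul trmxCK hQ mulmxA.
- by rewrite XA !trmxC_mul trmxCK hP mulmxA.
Qed.

Section WeakGroup.
Variables (n : nat) (A : 'M[C]_n).

Definition coreEP : 'M[C]_n :=
  drazin A *m A ^+ mxindex A *m mpinv (A ^+ mxindex A).

Definition weak_group_inv (m : nat) : 'M[C]_n := coreEP ^+ m.+1 *m A ^+ m.

End WeakGroup.
End MoorePenrose.

(* Main.v *)
Require Import Defs.
From mathcomp Require Import all_boot all_order all_algebra.
From mathcomp Require Import reals complex.
Import Order.TTheory GRing.Theory Num.Theory.
Local Open Scope ring_scope.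

(** An outer inverse [X] of [A] is determined by the two products [AX] and
    [XA] ([outer_inverse_uniq]), so the system has at most one solution, and it
    suffices to check that the proposed [X] solves it.

    Write [E] for the core-EP inverse, [D] for the Drazin inverse and
    [W = E ^ (m + 1) A ^ m].  Since [DAE = E], also [DAW = W], so the proposed
    solution is [X = D A1 A^+ = W A A^+], where [A^+] is the Moore-Penrose
    inverse.  Then [AX = A1 A^+] by associativity, [XA = WA = D A1] because
    [A A^+ A = A], and [XAX = (WAW) A A^+].  Everything thus reduces to [W]
    being itself an outer inverse of [A] ([pow_outer_inverse]), which follows
    from the identities [A E E = E] and [E A E = E] ([core_inverse_fixed]
    and [core_inverse_outer]). *)

(** The chain [x = (xa)x = (ya)x = y(ax) = y(ay) = y]. *)
Lemma outer_inverse_uniq (S : pzRingType) (a x y : S) :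
  x * a * x = x -> y * a * y = y -> a * x = a * y -> x * a = y * a -> x = y.
Proof. by move=> xax yay eax exa; rewrite -xax exa -mulrA eax mulrA. Qed.

(** The hypothesis [a e^2 = e] lets the powers telescope:
    [a^(j+1) e^(j+1)] loses one factor on each side until [a e] remains. *)
Lemma exp_mul_collapse (S : pzRingType) (a e : S) j :
  a * e * e = e -> a ^+ j.+1 * e ^+ j.+1 = a * e.
Proof.
move=> aee; elim: j => [//|j IH].
rewrite [a ^+ j.+2]exprSr [e ^+ j.+2]exprS [e ^+ j.+1]exprS.
by rewrite -mulrA (mulrA a) (mulrA (a * e)) aee -exprS IH.
Qed.

(** In [w a w] the middle part [a^(m+1) e^(m+1)] collapses to [a e], which the
    power [e^(m+1)] on its left absorbs. *)
Lemma pow_outer_inverse (S : pzRingType) (a e : S) m :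
  a * e * e = e -> e * a * e = e ->
  let w := e ^+ m.+1 * a ^+ m in w * a * w = w.
Proof.
move=> aee eae /=.
rewrite -(mulrA _ (a ^+ m) a) -exprSr mulrA -(mulrA _ (a ^+ m.+1)).
by rewrite exp_mul_collapse// exprSr -(mulrA _ e (a * e)) (mulrA e) eae.
Qed.

Section CoreEPAlgebra.
Variables (S : pzRingType) (a d g : S) (k : nat).
Hypotheses (dad : d * a * d = d) (comm_ad : a * d = d * a).
Hypotheses (adk : a ^+ k.+1 * d = a ^+ k) (kgk : a ^+ k * g * a ^+ k = a ^+ k).

(** The core-EP inverse, with any inner inverse of [a ^+ k] in place of its
    Moore-Penrose inverse. *)
Let e : S := d * a ^+ k * g.

(** On the range of [a ^+ k] the element [d] is a genuine inverse of [a], so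
    multiplying by [a] leaves the projector [a ^+ k * g] onto that range. *)
Lemma mul_core_inverse : a * e = a ^+ k * g.
Proof.
have comm_dk : a ^+ k.+1 * d = d * a ^+ k.+1.
  by apply/commr_sym/commrX/commr_sym.
by rewrite /e !mulrA comm_ad -(mulrA d) -exprS -comm_dk adk.
Qed.

(** Since [d] commutes with [a ^+ k], also [e = a ^+ k * d * g] lies in the range
    of the projector [a * e]. *)
Lemma core_inverse_fixed : a * e * e = e.
Proof.
have comm_dk : d * a ^+ k = a ^+ k * d.
  by apply: commrX; apply: commr_sym.
by rewrite mul_core_inverse /e comm_dk !mulrA kgk.
Qed.

Lemma core_inverse_outer : e * a * e = e.
Proof.
by rewrite -mulrA mul_core_inverse /e -!mulrA; congr (_ * _); rewrite !mulrA kgk.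
Qed.

(** [e] starts with the factor [d], which [d * a] fixes. *)
Lemma mul_drazin_pow_core_inverse m :
  d * a * (e ^+ m.+1 * a ^+ m) = e ^+ m.+1 * a ^+ m.
Proof. by rewrite exprS /e !mulrA dad. Qed.

End CoreEPAlgebra.

Section WeakGroupInverse.
Variables (C : numClosedFieldType) (n : nat) (A : 'M[C]_n).

Lemma mul_drazin_weak_group_inv m :
  drazin A *m A *m weak_group_inv A m = weak_group_inv A m.
Proof.
have [DAD _ _] := drazinP A.
exact: (@mul_drazin_pow_core_inverse 'M[C]_n A _ _ _ DAD).
Qed.

Lemma weak_group_inv_outer m :
  weak_group_inv A m *m A *m weak_group_inv A m = weak_group_inv A m.
Proof.
have [_ AD ADk] := drazinP A.
have [PGP _ _ _] := mpinvP (A ^+ mxindex A).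
apply: (@pow_outer_inverse 'M[C]_n).
- exact: (@core_inverse_fixed 'M[C]_n _ _ _ _ AD ADk PGP).
- exact: (@core_inverse_outer 'M[C]_n _ _ _ _ AD ADk PGP).
Qed.

Lemma weak_group_system_sol m :
  let A1 := A *m weak_group_inv A m *m A in
  let X := drazin A *m A1 *m mpinv A in
  [/\ X *m A *m X = X, A *m X = A1 *m mpinv A & X *m A = drazin A *m A1].
Proof.
have [AGA _ _ _] := mpinvP A.
move: (mul_drazin_weak_group_inv m) (weak_group_inv_outer m).
(* Generalized, because rewriting with [mulmxA] would unfold the product in
   the weak group inverse. *)
move: (weak_group_inv A m) => W DAW WAW A1 X.
have DA1 : drazin A *m A1 = W *m A by rewrite /A1 !mulmxA DAW.
rewrite /X DA1; split.
- rewrite -(mulmxA W A (mpinv A)) -(mulmxA W _ A) AGA.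
  by rewrite !mulmxA WAW.
- by rewrite !mulmxA.
- by rewrite -(mulmxA W A) -(mulmxA W _ A) AGA.
Qed.

End WeakGroupInverse.

Theorem theorem3p4 (R : realType) (n : nat) (A : 'M[R[i]]_n)
    (k : nat) (hk : mxindex A = k) (m : nat) (hm : (0 < m)%N)
    (A1 : 'M[R[i]]_n) (hA1 : A1 = A *m weak_group_inv A m *m A) :
  let system (X : 'M[R[i]]_n) : Prop :=
    [/\ X *m A *m X = X,
        A *m X = A1 *m mpinv A &
        X *m A = drazin A *m A1] in
  [/\ exists X : 'M[R[i]]_n, system X,
      forall X : 'M[R[i]]_n, system X -> X = drazin A *m A1 *m mpinv A &
      drazin A *m A1 *m mpinv A =
        drazin A *m A *m weak_group_inv A m *m A *m mpinv A].
Proof.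
move=> system; subst A1.
have sol : system (drazin A *m (A *m weak_group_inv A m *m A) *m mpinv A).
  exact: weak_group_system_sol.
split; first by exists (drazin A *m (A *m weak_group_inv A m *m A) *m mpinv A).
- move=> X [XAX AX XA]; have [YAY AY YA] := sol.
  apply: (@outer_inverse_uniq 'M_n A _ _ XAX YAY).
  + exact: etrans AX (esym AY).
  + exact: etrans XA (esym YA).
- by rewrite !mulmxA.
Qed.
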